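(* Let $X$ be a Banach space over $\mathbb{F}$ ($\mathbb{F}=\mathbb{R}$ or $\mathbb{C}$), let $\mathcal{L}$ be a subspace lattice on $X$ such that $\vee\{L:L\in\mathcal{P}_{\mathcal{L}}\}=X$ and $\wedge\{L_-:L\in\mathcal{P}_{\mathcal{L}}\}=(0)$, and let $\delta:\mathrm{Alg}\mathcal{L}\to B(X)$ be a linear mapping. Then the following are equivalent: (a) $\delta$ is a generalized derivation; (b) $\delta$ is a local generalized derivation; (c) $A\delta(B)C=0$ whenever $A,B,C\in\mathrm{Alg}\mathcal{L}$ satisfy $AB=BC=0$.
   Context: $B(X)$ is the algebra of bounded linear operators on $X$. A subspace of $X$ means a norm-closed linear manifold. A subspace lattice on $X$ is a collection $\mathcal{L}$ of subspaces of $X$ containing $(0)$ and $X$ such that for every family $\{M_r\}$ in $\mathcal{L}$ the intersection $\wedge M_r$ and the closed linear span $\vee M_r$ belong to $\mathcal{L}$ (the closed span of an empty family is $(0)$, and the intersection of an empty family is $X$). $\mathrm{Alg}\mathcal{L}$ is the algebra of operators in $B(X)$ that leave every member of $\mathcal{L}$ invariant. For $E\in\mathcal{L}$, $E_-=\vee\{F\in\mathcal{L}:F\nsupseteq E\}$, and $\mathcal{P}_{\mathcal{L}}=\{L\in\mathcal{L}:L_-\nsupseteq L\}$. A linear mapping $\delta:\mathrm{Alg}\mathcal{L}\to B(X)$ is a generalized derivation if $\delta(AB)=\delta(A)B+A\delta(B)-A\delta(I)B$ for all $A,B\in\mathrm{Alg}\mathcal{L}$. A linear mapping $\delta$ is a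 local generalized derivation if for every $A\in\mathrm{Alg}\mathcal{L}$ there is a (linear) generalized derivation $\delta_A:\mathrm{Alg}\mathcal{L}\to B(X)$, depending on $A$, such that $\delta(A)=\delta_A(A)$. *)

(* Defs.v *)
From HB Require Import structures.
From mathcomp Require Import all_boot all_order all_algebra.
From mathcomp Require Import all_classical all_reals all_analysis.
From mathcomp Require Import complex.

Set Implicit Arguments.
Unset Strict Implicit.
Unset Printing Implicit Defensive.

Import Order.TTheory GRing.Theory Num.Theory.
Import numFieldNormedType.Exports.

Local Open Scope classical_set_scope.
Local Open Scope ring_scope.

Section BoundedOperators.
Context {K : numFieldType} {X : normedModType K}.

Definition bounded_operator (f : X -> X) : Prop :=
  linear f /\ exists M : K, forall x, `|f x| <= M * `|x|.

Definition bounded_operator_pred : {pred X -> X} :=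
  fun f => `[< bounded_operator f >].

Lemma bounded_operator_submod : submod_closed bounded_operator_pred.
Proof.
split=> [|a f g /asboolP[fl [M fM]] /asboolP[gl [N gN]]]; apply/asboolP; split.
- by move=> a x y /=; rewrite [LHS]/(0 : X) scaler0 addr0.
- by exists 0 => x; rewrite mul0r normr0.
- move=> b x y; rewrite [LHS]/(a *: f (b *: x + y) + g (b *: x + y)).
  rewrite [X in _ = _ *: X + _]/(a *: f x + g x).
  rewrite [X in _ = _ + X]/(a *: f y + g y) fl gl !scalerDr !scalerA.
  by rewrite (mulrC a b) addrACA.
- exists (`|a| * M + N) => x; rewrite [X in `|X|]/(a *: f x + g x).
  rewrite (le_trans (ler_normD _ _))// mulrDl lerD// normrZ -mulrA.
  by rewrite ler_wpM2l.
Qed.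

HB.instance Definition _ :=
  GRing.isSubmodClosed.Build K (X -> X) bounded_operator_pred
    bounded_operator_submod.

End BoundedOperators.

(* The algebra B(X): addition and scaling are pointwise, the product is
   composition and the unit is the identity. It is a pzRingType and an
   lmodType but not an algType: algTypes are nontrivial, while 1 = 0 when X is
   the zero space; bop_scaleAl and bop_scaleAr relate the two structures. *)
Record bop (K : numFieldType) (X : normedModType K) := Bop {
  bop_fun :> X -> X;
  _ : bop_fun \in bounded_operator_pred }.

Section BopAlgebra.
Context {K : numFieldType} {X : normedModType K}.

HB.instance Definition _ := [isSub for @bop_fun K X].
HB.instance Definition _ := [Choice of bop X by <:].
HB.instance Definition _ := [SubChoice_isSubLmodule of bop X by <:].

Implicit Types S T U : bop X.

Lemma bopP S : bounded_operator S.
Proof. by case: S => f /= /asboolP. Qed.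

Lemma bop_linear S : linear S.
Proof. by have [] := bopP S. Qed.

Lemma bopD S x y : S (x + y) = S x + S y.
Proof. by have := bop_linear S 1 x y; rewrite /= !scale1r. Qed.

Lemma bop0 S : S 0 = 0.
Proof. by apply: (addrI (S 0)); rewrite -bopD !addr0. Qed.

Lemma bopZ S (a : K) x : S (a *: x) = a *: S x.
Proof. by have := bop_linear S a x 0; rewrite /= bop0 !addr0. Qed.

Lemma bop_ext S T : S =1 T -> S = T.
Proof. by move=> ST; apply/val_inj/funext. Qed.

Lemma bop_id_subproof : (id : X -> X) \in bounded_operator_pred.
Proof. by apply/asboolP; split=> //; exists 1 => x; rewrite mul1r. Qed.

Lemma bop_comp_subproof S T : (S \o T : X -> X) \in bounded_operator_pred.
Proof.
apply/asboolP; have [Sl [M SM]] := bopP S; have [Tl [N TN]] := bopP T.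
split=> [a x y|]; first by rewrite /= Tl Sl.
have [x0|/forallNP X0] := pselect (exists x : X, x != 0); last first.
  have X_eq0 (x : X) : x = 0 by apply: contrapT => /eqP; exact: X0.
  by exists 0 => x; rewrite (X_eq0 (_ x)) normr0 mul0r.
have M0 : 0 <= M.
  case: x0 => x x0; rewrite -(pmulr_lge0 _ (_ : 0 < `|x|)) ?normr_gt0//.
  exact: le_trans (SM x).
by exists (M * N) => x; rewrite (le_trans (SM _))// -mulrA ler_wpM2l.
Qed.

Definition bop_one : bop X := Bop bop_id_subproof.
Definition bop_mul S T : bop X := Bop (bop_comp_subproof S T).

Let bop_mulA : associative bop_mul.
Proof. by move=> S T U; apply: bop_ext. Qed.
Let bop_mul1 : left_id bop_one bop_mul.
Proof. by move=> S; apply: bop_ext. Qed.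
Let bop_mulr1 : right_id bop_one bop_mul.
Proof. by move=> S; apply: bop_ext. Qed.
Let bop_mulDl : left_distributive bop_mul +%R.
Proof. by move=> S T U; apply: bop_ext. Qed.
Let bop_mulDr : right_distributive bop_mul +%R.
Proof. by move=> S T U; apply: bop_ext => x; exact: (bopD S (T x) (U x)). Qed.

HB.instance Definition _ := GRing.Zmodule_isPzRing.Build (bop X)
  bop_mulA bop_mul1 bop_mulr1 bop_mulDl bop_mulDr.

Lemma bop_scaleAl (a : K) S T : a *: (S * T) = a *: S * T.
Proof. exact: bop_ext. Qed.

Lemma bop_scaleAr (a : K) S T : a *: (S * T) = S * (a *: T).
Proof. by apply: bop_ext => x; exact/esym/(bopZ S a (T x)). Qed.

End BopAlgebra.

Section SubspaceLattices.
Context {K : numFieldType}.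

Definition closed_subspace {X : normedModType K} (M : set X) : Prop :=
  [/\ M 0, forall (a : K) x y, M x -> M y -> M (a *: x + y) & closed M].

Definition linear_span {X : normedModType K} (A : set X) : set X :=
  [set x | exists n (a : 'I_n -> K) (v : 'I_n -> X),
     (forall i, A (v i)) /\ x = \sum_(i < n) a i *: v i].

Definition closed_span {X : normedModType K} (A : set X) : set X :=
  closure (linear_span A).

Definition subspace_join {X : normedModType K} (F : set (set X)) : set X :=
  closed_span (\bigcup_(M in F) M).

Record subspace_lattice (X : normedModType K) := SubspaceLattice {
  lattice_set :> set X -> Prop;
  lattice_subspace : forall M, lattice_set M -> closed_subspace M;
  lattice0 : lattice_set [set 0];
  latticeT : lattice_set setT;
  lattice_meet : forall F : set (set X),
    F `<=` lattice_set -> lattice_set (\bigcap_(M in F) M);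
  lattice_join : forall F : set (set X),
    F `<=` lattice_set -> lattice_set (subspace_join F) }.

(* E_- *)
Definition lattice_minus {X : normedModType K} (L : subspace_lattice X)
    (E : set X) : set X :=
  subspace_join [set F | L F /\ ~ (E `<=` F)].

(* P_L *)
Definition lattice_P {X : normedModType K} (L : subspace_lattice X) :
    set (set X) :=
  [set E | L E /\ ~ (E `<=` lattice_minus L E)].

Definition leaves_invariant {X : normedModType K} (L : subspace_lattice X) :
    {pred bop X} :=
  fun A => `[< forall M, L M -> A @` M `<=` M >].

Lemma leaves_invariant_submod (X : normedModType K) (L : subspace_lattice X) :
  submod_closed (leaves_invariant L).
Proof.
split=> [|a A B /asboolP AL /asboolP BL]; apply/asboolP => M LM.
  move=> _ [x _ <-]; rewrite [X in M X]/(0 : X).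
  by have [] := lattice_subspace LM.
move=> _ [x Mx <-]; rewrite [X in M X]/(a *: A x + B x).
have [_ Ml _] := lattice_subspace LM.
by apply: Ml; [apply: (AL M)|apply: (BL M)] => //; exists x.
Qed.

Lemma leaves_invariant_mul (X : normedModType K) (L : subspace_lattice X) :
  mulr_closed (leaves_invariant L).
Proof.
split=> [|A B /asboolP AL /asboolP BL]; apply/asboolP => M LM.
  by move=> _ [x Mx <-].
move=> _ [x Mx <-]; apply: (AL M LM); exists (B x) => //.
by apply: (BL M LM); exists x.
Qed.

HB.instance Definition _ (X : normedModType K) (L : subspace_lattice X) :=
  GRing.isSubmodClosed.Build K (bop X) (leaves_invariant L)
    (leaves_invariant_submod L).
HB.instance Definition _ (X : normedModType K) (L : subspace_lattice X) :=
  GRing.isMulClosed.Build (bop X) (leaves_invariant L)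
    (leaves_invariant_mul L).

End SubspaceLattices.

Record Alg (K : numFieldType) (X : normedModType K) (L : subspace_lattice X) :=
  MkAlg { alg_op :> bop X; _ : alg_op \in leaves_invariant L }.

Section AlgDerivations.
Context {K : numFieldType} {X : normedModType K} {L : subspace_lattice X}.

HB.instance Definition _ := [isSub for @alg_op K X L].
HB.instance Definition _ := [Choice of Alg L by <:].
HB.instance Definition _ := [SubChoice_isSubLmodule of Alg L by <:].
HB.instance Definition _ :=
  GRing.SubZmodule_isSubPzRing.Build (bop X) (leaves_invariant L) (Alg L)
    (subringClosedP _).

Definition generalized_derivation (delta : {linear Alg L -> bop X}) : Prop :=
  forall A B : Alg L,
    delta (A * B) =
      delta A * (B : bop X) + (A : bop X) * delta B
      - (A : bop X) * delta 1 * (B : bop X).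

Definition local_generalized_derivation (delta : {linear Alg L -> bop X}) :
    Prop :=
  forall A : Alg L, exists deltaA : {linear Alg L -> bop X},
    generalized_derivation deltaA /\ delta A = deltaA A.

End AlgDerivations.

(* Main.v *)
(* The difficulty is to deduce (a) from (c). Cutting A along idempotents P and Q
   on both sides turns (c) into the "bilocal" identity
     delta(P A Q) + P delta(A) Q = delta(P A) Q + P delta(A Q),
   which is linear in P and in Q. For E in P_L, the rank-one operators g(.) x
   with x in E and g in the annihilator of E_- belong to Alg L and, by
   Hahn-Banach, are linear combinations of idempotents of the same kind. They
   form an ideal of Alg L, so the bilocal identity can be applied to (S, AB, T),
   (SA, B, T), (S, A, BT) and (SA, 1, BT) for S and T of this form. An
   alternating sum gives
     S (delta(AB) - delta(A) B - A delta(B) + A delta(1) B) T = 0,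
   and the two lattice hypotheses, with Hahn-Banach again, allow cancelling S
   and T. *)
Require Import Defs.
From mathcomp Require Import all_boot all_order all_algebra.
From mathcomp Require Import all_classical all_reals all_analysis.
From mathcomp Require Import complex ring.
Set Implicit Arguments.
Unset Strict Implicit.
Unset Printing Implicit Defensive.

Import Order.TTheory GRing.Theory Num.Theory.
Import numFieldNormedType.Exports.
Local Open Scope classical_set_scope.
Local Open Scope ring_scope.

(** * Dominated linear functionals by Zorn's lemma *)

Section HahnBanach.
(* The embedding r stands for the identity of R or for the inclusion of R in
   R[i]: complex spaces are treated as real ones through r a *: x. *)
Context {R : realType} {K : numFieldType} {V : lmodType K}.
Context (r : {rmorphism R -> K}).
Implicit Types (p q : V -> R) (C : set (V * R)).

Definition sublinear q :=
  (forall x y, q (x + y) <= q x + q y) /\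
  (forall a x, 0 < a -> q (r a *: x) <= a * q x).

Definition convex_cone C :=
  [/\ C (0, 0), forall u v, C u -> C v -> C (u + v) &
      forall a u, 0 < a -> C u -> C (r a *: u.1, a * u.2)].

(** For sublinear [q] and a convex cone [C] with [u.2 <= q u.1] on it, the linear functionals below
    [cone_inf q C] are those below [q] with [u.2 <= f u.1] on [C]. *)
Definition cone_inf q C x := inf [set q (x + u.1) - u.2 | u in C].

Lemma sublinear_scale q a x : sublinear q -> 0 < a -> q (r a *: x) = a * q x.
Proof.
move=> [_ qZ] a0; apply/le_anti; rewrite qZ//=.
have := qZ a^-1 (r a *: x); rewrite invr_gt0 => /(_ a0).
rewrite scalerA -rmorphM mulVf ?gt_eqF// rmorph1 scale1r.
by rewrite ler_pdivlMl.
Qed.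

Lemma sublinear0 q : sublinear q -> q 0 = 0.
Proof.
move=> sq; have := @sublinear_scale q 2 0 sq; rewrite scaler0 => /(_ _)/eqP.
by rewrite mulr_natl mulr2n -subr_eq subrr eq_sym => /(_ _)/eqP; apply.
Qed.

Lemma sublinear_geN p q x : sublinear q -> (forall y, q y <= p y) ->
  - p (- x) <= q x.
Proof.
move=> sq qp; rewrite lerNl (le_trans _ (qp _))// lerNl.
by rewrite -subr_ge0 opprK -(sublinear0 sq) -(subrr x) sq.1.
Qed.

Section ConeInf.
Context {q C} (sq : sublinear q) (cC : convex_cone C).
Context (qC : forall u, C u -> u.2 <= q u.1).

Lemma cone_inf_le x u : C u -> cone_inf q C x <= q (x + u.1) - u.2.
Proof.
move=> Cu; apply: ge_inf; last by exists u.
(* [inf] is meaningful only on a set bounded below; [qC] and subadditivity give this bound. *)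
exists (- q (- x)) => _ [v Cv <-]; rewrite lerBrDr -lerBrDl opprK.
rewrite (le_trans (qC _))//.
by rewrite -{1}(addKr x v.1) (le_trans (sq.1 _ _))// addrC.
Qed.

Lemma le_cone_inf x y : (forall u, C u -> y <= q (x + u.1) - u.2) ->
  y <= cone_inf q C x.
Proof.
move=> h; apply: lb_le_inf => [|_ [u Cu <-]]; last exact: h.
by case: cC => C0 _ _; exists (q (x + 0) - 0), (0, 0).
Qed.

Lemma sublinear_cone_inf : sublinear (cone_inf q C).
Proof.
case: cC => _ CD CZ; split => [x y|a x a0].
  rewrite -lerBlDr; apply: le_cone_inf => u Cu.
  rewrite lerBlDl -lerBlDr; apply: le_cone_inf => v Cv.
  rewrite lerBlDl (le_trans (cone_inf_le _ (CD _ _ Cu Cv)))//=.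
  by rewrite addrACA opprD [leRHS]addrACA lerD2r sq.1.
rewrite mulrC -ler_pdivrMr//; apply: le_cone_inf => u Cu.
rewrite ler_pdivrMr// (le_trans (cone_inf_le _ (CZ _ _ a0 Cu)))//=.
by rewrite -scalerDr sublinear_scale// mulrBl mulrC [u.2 * _]mulrC.
Qed.

Lemma cone_inf_le_id x : cone_inf q C x <= q x.
Proof.
case: cC => C0 _ _.
by have := @cone_inf_le x _ C0; rewrite /= addr0 subr0.
Qed.

End ConeInf.

(** Zorn's lemma: the pointwise infimum of a nonempty chain of sublinear functionals below [p] is
    again one, kept finite by [- p (- x)]. *)
Lemma minimal_sublinear p : sublinear p -> exists q,
  [/\ sublinear q, forall x, q x <= p x &
      forall q', sublinear q' -> (forall x, q' x <= q x) ->
        forall x, q x <= q' x].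
Proof.
move=> sp.
pose T := {q : V -> R | sublinear q /\ forall x, q x <= p x}.
(* Zorn's lemma yields maximal elements, so smaller functionals are placed higher. *)
pose le_op (q1 q2 : T) := `[< forall x, sval q2 x <= sval q1 x >].
have pT : sublinear p /\ forall x, p x <= p x by split.
have [| |A Atot|[q [sq qp]] qmin] := @ZL_preorder T (exist _ p pT) le_op.
- by move=> q; apply/asboolP.
- move=> q1 q2 q3 /asboolP q21 /asboolP q32; apply/asboolP => x.
  exact: le_trans (q32 x) (q21 x).
- have [[q0 Aq0]|A0] := pselect (A !=set0); last first.
    by exists (exist _ p pT) => s As; case: A0; exists s.
  pose g x := inf [set sval s x | s in A].
  have gle s x : A s -> g x <= sval s x.
    move=> As; apply: ge_inf; last by exists s.
    exists (- p (- x)) => _ [t _ <-]; have [st tp] := svalP t.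
    exact: sublinear_geN.
  have leg x y : (forall s, A s -> y <= sval s x) -> y <= g x.
    move=> h; apply: lb_le_inf => [|_ [s As <-]]; last exact: h.
    by exists (sval q0 x), q0.
  have gT : sublinear g /\ forall x, g x <= p x.
    split; last by move=> x; apply: le_trans (gle _ _ Aq0) ((svalP q0).2 x).
    split=> [x y|a x a0].
      rewrite -lerBlDr; apply: (leg) => s As.
      rewrite lerBlDl -lerBlDr; apply: (leg) => t At.
      (* The smaller of the two chain members bounds both terms. *)
      rewrite lerBlDl; have [/asboolP st|/asboolP ts] := Atot _ _ As At.
        rewrite (le_trans (gle _ _ At))// (le_trans ((svalP t).1.1 x y))//.
        by rewrite lerD2r.
      rewrite (le_trans (gle _ _ As))// (le_trans ((svalP s).1.1 x y))//.
      by rewrite lerD2l.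
    rewrite mulrC -ler_pdivrMr//; apply: (leg) => s As.
    rewrite ler_pdivrMr// (le_trans (gle _ _ As))// mulrC.
    exact: (svalP s).1.2.
  by exists (exist _ g gT) => s As; apply/asboolP => x; exact: gle.
exists q; split => // q' sq' q'q.
have q'T : sublinear q' /\ forall x, q' x <= p x.
  by split=> // x; exact: le_trans (q'q x) (qp x).
by have /asboolP := qmin (exist _ q' q'T) (asboolT q'q).
Qed.

(* If q is minimal then q agrees with the sublinear functional
   x |-> inf_(t >= 0) (q (x + t v) - t q v), so q x + q v <= q (x + v). *)
Lemma dominated_linear_functional p : sublinear p -> exists f : V -> R,
  [/\ forall x y, f (x + y) = f x + f y,
      forall a x, f (r a *: x) = a * f x & forall x, f x <= p x].
Proof.
move=> /minimal_sublinear[q [sq qp qmin]]; exists q.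
have qD x v : q (x + v) = q x + q v.
  pose C := [set u : V * R | exists2 t, 0 <= t & u = (r t *: v, t * q v)].
  have cC : convex_cone C.
    split => [|u w [s s0 ->] [t t0 ->]|a u a0 [t t0 ->] /=].
    - by exists 0 => //; rewrite rmorph0 scale0r mul0r.
    - by exists (s + t); [exact: addr_ge0|rewrite rmorphD scalerDl mulrDl].
    - exists (a * t); first by rewrite mulr_ge0// ltW.
      by rewrite scalerA -rmorphM mulrA.
  have qC u : C u -> u.2 <= q u.1.
    case=> t; rewrite le_eqVlt => /predU1P[<-|t0] ->/=.
      by rewrite rmorph0 scale0r mul0r sublinear0.
    by rewrite sublinear_scale.
  apply/le_anti; rewrite sq.1/= -lerBrDr.
  have := qmin _ (sublinear_cone_inf sq cC qC) (cone_inf_le_id sq cC qC) x.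
  move=> /le_trans; apply.
  have Cv : C (v, q v) by exists 1 => //; rewrite rmorph1 scale1r mul1r.
  by rewrite (le_trans (cone_inf_le sq qC x Cv)).
have qN x : q (- x) = - q x.
  by apply/eqP; rewrite -addr_eq0 -qD addNr sublinear0.
split => // a x; have [a0|a0|<-] := ltgtP 0 a.
- exact: sublinear_scale.
- by rewrite -[a]opprK rmorphN scaleNr qN sublinear_scale ?oppr_gt0// !mulNr.
- by rewrite rmorph0 scale0r mul0r sublinear0.
Qed.

(** Domination by [cone_inf p C], evaluated at [- u.1], turns an upper bound into [u.2 <= f u.1]. *)
Lemma linear_functional_above_cone p C : sublinear p -> convex_cone C ->
  (forall u, C u -> u.2 <= p u.1) -> exists f : V -> R,
  [/\ forall x y, f (x + y) = f x + f y,
      forall a x, f (r a *: x) = a * f x,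
      forall x, f x <= p x & forall u, C u -> u.2 <= f u.1].
Proof.
move=> sp cC pC.
have [f [fD fZ fp]] :=
  dominated_linear_functional (sublinear_cone_inf sp cC pC).
exists f; split => // [x|u Cu].
  exact: le_trans (fp x) (cone_inf_le_id sp cC pC x).
have fN : f (- u.1) = - f u.1.
  by rewrite -scaleN1r -(rmorph1 r) -rmorphN fZ mulN1r.
rewrite -lerN2 -fN (le_trans (fp _))//.
rewrite (le_trans (cone_inf_le sp pC _ Cu))// addNr (sublinear0 sp).
by rewrite sub0r.
Qed.

End HahnBanach.

(** * Separation of a point from a closed subspace *)

Section Separation.
Context {K : numFieldType} {X : normedModType K}.

Definition bounded_functional (g : X -> K) :=
  (forall a x y, g (a *: x + y) = a * g x + g y) /\
  exists2 c, 0 <= c & forall x, `|g x| <= c * `|x|.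

Lemma closed_subspace_dist (M : set X) z : closed M -> ~ M z ->
  exists2 e : K, 0 < e & forall m, M m -> ~~ (`|z - m| < e).
Proof.
move=> Mc Mz; have /open_nbhs_nbhs := conj (closed_openC Mc) (Mz : (~` M) z).
move=> /nbhs_ballP[e /= e0 ze]; exists e => // m Mm; apply/negP => zm.
by apply: (ze m) => //; rewrite -ball_normE.
Qed.

Context {R : realType} (r : {rmorphism R -> K}) (N : X -> R).
Context (ler_r : forall a b, (r a <= r b) = (a <= b)).
Context (r_onto : forall e, 0 < e -> exists a, r a = e).
Context (rN : forall x, r (N x) = `|x|).

(** With [e] at most the distance from [z] to [M], the functional is required to be at least [t * e]
    at [t z + m] for [t >= 0] and [m] in [M]. Taking [t = 0] makes it nonnegative on [M = - M],
    hence zero there; [t = 1], [m = 0] makes it positive at [z]. *)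
Lemma real_separation (M : set X) z : closed_subspace M -> ~ M z ->
  exists f : X -> R,
  [/\ forall x y, f (x + y) = f x + f y,
      forall a x, f (r a *: x) = a * f x,
      forall x, `|f x| <= N x,
      forall m, M m -> f m = 0 & 0 < f z].
Proof.
move=> [M0 Ml Mc] Mz.
have [_ /[dup]/r_onto[e <-] re0 eM] := closed_subspace_dist Mc Mz.
have e0 : 0 < e.
  by rewrite lt_def -ler_r rmorph0 ltW// andbT -(fmorph_eq0 r) gt_eqF.
have {eM}eN m : M m -> e <= N (z - m).
  move=> /eM; rewrite -rN => h; rewrite leNgt; apply: contra h => h.
  by rewrite lt_def ler_r ltW// andbT fmorph_eq gt_eqF.
have Mscale a m : M m -> M (a *: m).
  by move=> Mm; have := Ml a m 0 Mm M0; rewrite addr0.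
have MD x y : M x -> M y -> M (x + y).
  by move=> Mx My; rewrite -[x]scale1r; exact: Ml.
have NZ a x : 0 <= a -> N (r a *: x) = a * N x.
  move=> a0; apply: (fmorph_inj r); rewrite rmorphM !rN normrZ ger0_norm//.
  by rewrite -(rmorph0 r) ler_r.
have N0 x : 0 <= N x by rewrite -ler_r rmorph0 rN.
have sN : sublinear r N.
  split => [x y|a x /ltW/NZ-> //].
  by rewrite -ler_r rmorphD !rN ler_normD.
pose C := [set u : X * R | exists t m,
  [/\ 0 <= t, M m & u = (r t *: z + m, t * e)]].
have cC : convex_cone r C.
  split => [|_ _ [s [m [s0 Mm ->]]] [t [n [t0 Mn ->]]]|
             a _ a0 [t [m [t0 Mm ->]]]].
  - by exists 0, 0; rewrite rmorph0 scale0r addr0 mul0r.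
  - exists (s + t), (m + n); split; [exact: addr_ge0|exact: MD|].
    by rewrite rmorphD scalerDl mulrDl addrACA.
  - exists (a * t), (r a *: m); split; first by rewrite mulr_ge0// ltW.
      exact: Mscale.
    by rewrite rmorphM -scalerA -scalerDr mulrA.
have NC u : C u -> u.2 <= N u.1.
  move=> [t [m [t0 Mm ->]]] /=; have [->|tn0] := eqVneq t 0.
    by rewrite mul0r.
  have rt0 : r t != 0 by rewrite fmorph_eq0.
  rewrite -[m](scalerKV rt0) -scalerDr NZ// ler_wpM2l//.
  by rewrite -[_ *: m]opprK eN// -scaleN1r; apply/Mscale/Mscale.
have [f [fD fZ fN fC]] := linear_functional_above_cone sN cC NC.
have fNx x : f (- x) = - f x.
  by rewrite -scaleN1r -(rmorph1 r) -rmorphN fZ mulN1r.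
have fM m : M m -> 0 <= f m.
  move=> Mm; apply: (fC (m, 0)); exists 0, m.
  by rewrite rmorph0 scale0r add0r mul0r.
exists f; split => // [x|m Mm|].
- rewrite ler_norml fN andbT lerNl -fNx (le_trans (fN _))//.
  by rewrite -ler_r !rN normrN.
- apply/le_anti; rewrite fM// andbT -oppr_ge0 -fNx fM//.
  by rewrite -scaleN1r; exact: Mscale.
- apply: (lt_le_trans e0); apply: (fC (z, e)); exists 1, 0.
  by rewrite rmorph1 scale1r addr0 mul1r.
Qed.

End Separation.

(** The form in which Hahn-Banach is used below; taken as a hypothesis, it lets the operator
    arguments treat both scalar fields at once. *)
Definition separates_closed_subspaces (K : numFieldType)
    (X : normedModType K) :=
  forall (M : set X) z, closed_subspace M -> ~ M z ->
  exists g : X -> K,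
  [/\ bounded_functional g, forall m, M m -> g m = 0 & g z != 0].

Lemma separates_real (R : realType) (X : normedModType R) :
  separates_closed_subspaces X.
Proof.
move=> M z Mcs Mz.
have [//||//|f [fD fZ fN fM fz]] :=
  @real_separation R X R idfun (fun x => `|x|) _ _ _ M z Mcs Mz.
  by move=> e _; exists e.
exists f; split => //; last by rewrite gt_eqF.
split => [a x y|]; first by rewrite fD fZ.
by exists 1 => // x; rewrite mul1r.
Qed.

(* The complex functional with real part f is x |-> f x - i f (i x). *)
Lemma separates_complex (R : realType) (X : normedModType R[i]) :
  separates_closed_subspaces X.
Proof.
move=> M z Mcs Mz.
pose r : {rmorphism R -> R[i]} := real_complex R.
have [|||f [fD fZ fN fM fz]] := @real_separation _ X R r
    (fun x => complex.Re `|x|) _ _ _ M z Mcs Mz.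
- by move=> a b; rewrite lecR.
- by move=> e e0; exists (complex.Re e); rewrite /r/= RRe_real// gtr0_real.
- by move=> x; rewrite /r/= RRe_real.
have fiD x y : f ('i%C *: (x + y)) = f ('i%C *: x) + f ('i%C *: y).
  by rewrite scalerDr fD.
have [M0 Ml _] := Mcs.
exists (fun x => Complex (f x) (- f ('i%C *: x))); split => [|m Mm|].
- split => [[a b] x y|].
    have abE (w : X) : Complex a b *: w = r a *: w + r b *: ('i%C *: w).
      rewrite scalerA -scalerDl; congr (_ *: _).
      by rewrite [LHS]complexE mulrC.
    have iabE (w : X) : 'i%C *: (Complex a b *: w) =
        r a *: ('i%C *: w) + r (- b) *: w.
      rewrite abE scalerDr !scalerA; congr (_ *: _ + _ *: _).
        by rewrite mulrC.
      by rewrite mulrAC -expr2 sqr_i mulN1r rmorphN.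
    rewrite fiD fD iabE abE !fD !fZ; apply/eqP; rewrite eq_complex/=.
    by apply/andP; split; apply/eqP; ring.
  (* One unit for each of the real and imaginary parts. *)
  exists 2 => // x.
  rewrite [X in `|X|]complexE/=; apply: le_trans (ler_normD _ _) _.
  rewrite mulr_natl mulr2n.
  have fle w : `|(f w)%:C%C| <= `|w| :> R[i].
    rewrite normc_def/= expr0n addr0 sqrtr_sqr.
    by rewrite -(RRe_real (normr_real w)) lecR.
  rewrite lerD// normrM -[leRHS]mul1r ler_pM//.
    by rewrite normc_def/= expr0n expr1n add0r sqrtr1.
  by rewrite rmorphN normrN (le_trans (fle _))// normrZ normc_def/= expr0n
    expr1n add0r sqrtr1 mul1r.
- rewrite fM// fM ?oppr0//.
  by have := Ml 'i%C m 0 Mm M0; rewrite addr0.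
- by rewrite eq_complex/= gt_eqF.
Qed.

Lemma separates_real_or_complex (R : realType) (K : numFieldType)
    (realK : K = (R : numFieldType) \/ K = (R[i] : numFieldType))
    (X : normedModType K) : separates_closed_subspaces X.
Proof.
by case: realK => E; subst K; [exact: separates_real|exact: separates_complex].
Qed.

(** * Bounded functionals and rank-one operators *)

Section BoundedFunctionals.
Context {K : numFieldType} {X : normedModType K}.
Implicit Types (x y : X) (g : X -> K).

Lemma linear_span_sub (A : set X) : A `<=` linear_span A.
Proof.
move=> x Ax; exists 1%N, (fun=> 1), (fun=> x); split=> //.
by rewrite big_ord1 scale1r.
Qed.

Lemma subspace_join_sub (F : set (set X)) M : F M -> M `<=` subspace_join F.
Proof.
by move=> FM x Mx; apply/subset_closure/linear_span_sub; exists M.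
Qed.

(** [bounded_operator] puts no sign on its constant, but a negative one can occur only on the zero
    space, where 0 serves. *)
Lemma bop_bound_ge0 (A : bop X) :
  exists2 c, 0 <= c & forall x, `|A x| <= c * `|x|.
Proof.
have [_ [c Ac]] := bopP A.
have [[x x0]|/forallNP X0] := pselect (exists x : X, x != 0).
  exists c => //; rewrite -(pmulr_lge0 _ (_ : 0 < `|x|)) ?normr_gt0//.
  exact: le_trans (Ac x).
exists 0 => // x; have /negP := X0 x; rewrite negbK => /eqP->.
by rewrite bop0 normr0 mulr0.
Qed.

Lemma bounded_functional_comp g (A : bop X) :
  bounded_functional g -> bounded_functional (g \o A).
Proof.
move=> [gl [c c0 gc]]; split => [a x y /=|]; first by rewrite bop_linear gl.
have [d d0 Ad] := bop_bound_ge0 A; exists (c * d); first exact: mulr_ge0.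
by move=> x /=; rewrite (le_trans (gc _))// -mulrA ler_wpM2l.
Qed.

Lemma bounded_functionalD g h : bounded_functional g -> bounded_functional h ->
  bounded_functional (g \+ h).
Proof.
move=> [gl [c c0 gc]] [hl [d d0 hd]]; split => [a x y /=|].
  by rewrite gl hl mulrDr addrACA.
exists (c + d); first exact: addr_ge0.
by move=> x; rewrite (le_trans (ler_normD _ _))// mulrDl lerD.
Qed.

Lemma rank_one_subproof x g : bounded_functional g ->
  (fun y => g y *: x) \in bounded_operator_pred.
Proof.
move=> [gl [c c0 gc]]; apply/asboolP; split => [a y z /=|].
  by rewrite gl scalerDl scalerA.
exists (c * `|x|) => y; rewrite normrZ mulrAC ler_wpM2r//.
Qed.

Definition rank_one x g (gb : bounded_functional g) : bop X :=
  Bop (rank_one_subproof x gb).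

End BoundedFunctionals.

(** * Rank-one operators in [Alg L] *)

Section RankOne.
Context {K : numFieldType} {X : normedModType K} {L : subspace_lattice X}.
Implicit Types (A B P : Alg L) (E : set X).

Lemma algP A E x : L E -> E x -> E ((A : bop X) x).
Proof. by case: A => A /= /asboolP AL LE Ex; apply: (AL _ LE); exists x. Qed.

Lemma lattice_minus_mem E : L (lattice_minus L E).
Proof. by apply: lattice_join => F []. Qed.

Definition admissible x (g : X -> K) := exists E,
  [/\ lattice_P L E, E x, bounded_functional g &
      forall y, lattice_minus L E y -> g y = 0].

Definition admissible_rank_one A := exists x g,
  admissible x g /\ forall y, (A : bop X) y = g y *: x.

(** A member [F] of [L] either contains [E], hence [x], or is among the subspaces spanning
    [lattice_minus L E], where [g] vanishes. *)
Lemma admissible_alg x g : admissible x g ->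
  exists A, forall y, (A : bop X) y = g y *: x.
Proof.
move=> [E [[LE _] Ex gb gE]].
suff AL : rank_one x gb \in leaves_invariant L by exists (MkAlg AL).
apply/asboolP => F LF _ [y Fy <-] /=.
have [F0 Fl _] := lattice_subspace LF.
have [EF|EF] := pselect (E `<=` F).
  by have := Fl (g y) x 0 (EF x Ex) F0; rewrite addr0.
by rewrite gE ?scale0r//; apply: (@subspace_join_sub _ _ _ F).
Qed.

(** The functional becomes [g \o B], which still vanishes on [lattice_minus L E] because that
    subspace belongs to [L] and so is invariant under [B]. *)
Lemma admissible_rank_oneMr A B :
  admissible_rank_one A -> admissible_rank_one (A * B).
Proof.
move=> [x [g [[E [PE Ex gb gE]] Ag]]]; exists x, (g \o (B : bop X)).
split => [|y]; last exact: Ag.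
exists E; split => // [|y Ey]; first exact: bounded_functional_comp.
by apply: gE; apply: algP Ey; exact: lattice_minus_mem.
Qed.

Lemma admissible_rank_oneMl A B :
  admissible_rank_one A -> admissible_rank_one (B * A).
Proof.
move=> [x [g [[E [[LE nE] Ex gb gE]] Ag]]]; exists ((B : bop X) x), g.
split => [|y]; first by exists E; split => //; exact: algP.
by rewrite -bopZ -Ag.
Qed.

(* If g x != 0 then g(.) x is a multiple of an idempotent. If g x = 0 but
   g z != 0 for some z in E, then g(.) x = g(.) (x + z) - g(.) z. If g vanishes
   on E, then g(.) x = (g + h)(.) x - h(.) x for some h that does not. *)
Lemma admissible_rank_one_ind (Q : Alg L -> Prop) :
  separates_closed_subspaces X ->
  (forall a A B, Q A -> Q B -> Q (a *: A + B)) ->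
  (forall P, P * P = P -> Q P) ->
  forall A, admissible_rank_one A -> Q A.
Proof.
move=> sepX Qlin Qid.
have Q0 : Q 0 by apply: Qid; rewrite mulr0.
have QB A B : Q A -> Q B -> Q (A - B).
  by move=> QA QB; rewrite addrC -scaleN1r; exact: Qlin.
have algE A B : (forall y, (A : bop X) y = (B : bop X) y) -> A = B.
  by move=> AB; apply/val_inj/bop_ext.
have Qneq0 A x g : admissible x g ->
    (forall y, (A : bop X) y = g y *: x) -> g x != 0 -> Q A.
  move=> [E [_ _ [gl _] _]] Ag gx0.
  have g0 : g 0 = 0.
    have := gl 1 0 0; rewrite scale1r addr0 mul1r => /eqP.
    by rewrite -subr_eq subrr eq_sym => /eqP.
  have gZ a y : g (a *: y) = a * g y by rewrite -[a *: y]addr0 gl g0 addr0.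
  (* [A] is [g x] times the idempotent [(g x)^-1 *: A]; the added 0 fits the shape of [Qlin]. *)
  rewrite -[A]addr0 -[A](scalerKV gx0); apply: Qlin => //; apply: Qid.
  apply: algE => y; pose c := (g x)^-1.
  rewrite -[LHS]/(c *: (A : bop X) (c *: (A : bop X) y)).
  rewrite -[RHS]/(c *: (A : bop X) y) !Ag !gZ; congr (_ *: (_ *: _)).
  by rewrite mulrCA mulVf// mulr1.
have QnE A E x g z : lattice_P L E -> E x -> bounded_functional g ->
    (forall y, lattice_minus L E y -> g y = 0) ->
    (forall y, (A : bop X) y = g y *: x) -> E z -> g z != 0 -> Q A.
  move=> PE Ex gb gE Ag Ez gz.
  have [gx|gx] := eqVneq (g x) 0; last by apply: (Qneq0 _ x g) => //; exists E.
  have Exz : E (x + z).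
    have [LE _] := PE; have [_ El _] := lattice_subspace LE.
    by rewrite -[x]scale1r; exact: El.
  have adxz : admissible (x + z) g by exists E.
  have adz : admissible z g by exists E.
  have [B Bg] := admissible_alg adxz; have [C Cg] := admissible_alg adz.
  have -> : A = B - C.
    apply: algE => y; rewrite -[RHS]/((B : bop X) y - (C : bop X) y).
    by rewrite Ag Bg Cg scalerDr addrK.
  apply: QB; [apply: (Qneq0 _ _ _ adxz Bg)|exact: (Qneq0 _ _ _ adz Cg)].
  have [gl _] := gb; have := gl 1 x z; rewrite scale1r => ->.
  by rewrite gx mulr0 add0r.
move=> A [x [g [[E [PE Ex gb gE]] Ag]]].
have [[z [Ez gz]]|gE0] := pselect (exists z, E z /\ g z != 0).
  exact: (QnE A E x g z).
have {}gE0 y : E y -> g y = 0.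
  by move=> Ey; apply: contrapT => /eqP gy; apply: gE0; exists y.
(* [E] is not contained in [lattice_minus L E], so some [z] in [E] can be separated from it; this
   gives the [h] that does not vanish on [E]. *)
have [LE /existsNP[z /not_implyP[Ez nEz]]] := PE.
have [h [hb hE hz]] := sepX _ _ (lattice_subspace (lattice_minus_mem E)) nEz.
have adh : admissible x h by exists E.
have ghb := bounded_functionalD gb hb.
have ghE y : lattice_minus L E y -> (g \+ h) y = 0.
  by move=> Ey /=; rewrite gE// hE// addr0.
have adgh : admissible x (g \+ h) by exists E.
have [B Bg] := admissible_alg adgh; have [C Cg] := admissible_alg adh.
have -> : A = B - C.
  apply: algE => y; rewrite -[RHS]/((B : bop X) y - (C : bop X) y).
  by rewrite Ag Bg Cg /= scalerDl addrK.
apply: QB; last exact: (QnE _ E _ _ z _ _ _ _ Cg).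
by apply: (QnE _ E _ _ z _ _ _ _ Bg) => //=; rewrite gE0// add0r.
Qed.

(** The meet hypothesis makes [R] vanish on every [E] in [lattice_P L]; the join hypothesis and
    continuity extend this to [X]. *)
Lemma admissible_rank_one_faithful (R : bop X) :
  separates_closed_subspaces X ->
  subspace_join (lattice_P L) = setT ->
  \bigcap_(E in lattice_P L) lattice_minus L E = [set 0] ->
  (forall S T, admissible_rank_one S -> admissible_rank_one T ->
    (S : bop X) * R * (T : bop X) = 0) -> R = 0.
Proof.
move=> sepX joinL meetL SRT.
have R0 E x : lattice_P L E -> E x -> R x = 0.
  move=> PE Ex; suff : [set 0] (R x) by [].
  rewrite -meetL => F PF; apply: contrapT => nFx.
  have [g [gb gF gx]] := sepX _ _ (lattice_subspace (lattice_minus_mem F)) nFx.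
  have [LE /existsNP[z /not_implyP[Ez nEz]]] := PE.
  have [h [hb hE hz]] := sepX _ _ (lattice_subspace (lattice_minus_mem E)) nEz.
  have [_ /existsNP[w /not_implyP[Fw nFw]]] := PF.
  have adg : admissible w g by exists F.
  have adh : admissible x h by exists E.
  have [S Sg] := admissible_alg adg; have [T Th] := admissible_alg adh.
  have S1 : admissible_rank_one S by exists w, g.
  have T1 : admissible_rank_one T by exists x, h.
  (* At [z] the product is [(h z * g (R x)) *: w] with both scalars nonzero, so [w = 0], although
     [w] lies outside a subspace. *)
  have /(congr1 (fun U : bop X => U z)) := SRT S T S1 T1.
  rewrite -[LHS]/((S : bop X) (R ((T : bop X) z))) -[RHS]/(0 : X).
  rewrite Th bopZ bopZ Sg => /eqP.
  rewrite !scaler_eq0 (negbTE hz) (negbTE gx)/=.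
  move=> /eqP w0; apply: nFw; rewrite w0.
  by have [] := lattice_subspace (lattice_minus_mem F).
have Rspan :
    linear_span (\bigcup_(E in lattice_P L) E) `<=` [set y | R y = 0].
  move=> _ [n [a [v [Fv ->]]]] /=.
  rewrite (big_morph R (bopD R) (bop0 R)) big1// => i _.
  by rewrite bopZ; have [E PE Ev] := Fv i; rewrite (R0 E)// scaler0.
apply: bop_ext => x; rewrite -[RHS]/(0 : X).
apply/eqP/negP => /negP Rx0.
have [c c0 Rc] := bop_bound_ge0 R.
(* Adding 1 allows division even if [c = 0]. A [y] in the span within this radius of [x] would give
   [(c + 1) * |x - y| < |R (x - y)| <= c * |x - y|]. *)
have c1 : 0 < c + 1 by rewrite ltr_wpDl.
have e0 : 0 < `|R x| / (c + 1) by rewrite divr_gt0// normr_gt0.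
have : closure (linear_span (\bigcup_(E in lattice_P L) E)) x.
  by rewrite -[closure _]/(subspace_join _) joinL.
move=> /(_ _ (nbhsx_ballx x _ e0))[y [/Rspan/= Ry]].
rewrite -ball_normE/= ltr_pdivlMr//.
have -> : R x = R (x - y) by rewrite bopD -scaleN1r bopZ Ry scaler0 addr0.
move=> /lt_le_trans/(_ (Rc _)); rewrite mulrC => /lt_geF.
by rewrite ler_wpM2r// lerDl.
Qed.

End RankOne.

(** * The bilocal identity and its consequence *)

(** The hypotheses are the four corners of the identity; it is the first minus the second and third
    plus the fourth. *)
Lemma idempotent_cut (T : pzRingType) (p q d e f g : T) :
  (1 - p) * d * (1 - q) = 0 -> p * (f - d) * (1 - q) = 0 ->
  (1 - p) * (e - d) * q = 0 -> p * (g - f - (e - d)) * q = 0 ->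
  d + p * g * q = e * q + p * f.
Proof.
rewrite !(mulrBl, mulrBr, mul1r, mulr1).
move=> /subr0_eq/(canRL (subrK _)) h1 /subr0_eq/(canRL (subrK _)) h2.
move=> /subr0_eq/(canRL (subrK _)) h3 /subr0_eq/(canRL (subrK _)) h4.
rewrite addrAC -addrA in h1.
by rewrite h2 h3 h4 {1}h1 addrACA [p * e * q - _ + d * q]addrC.
Qed.

Section Bilocal.
Context {K : numFieldType} {X : normedModType K} {L : subspace_lattice X}.
Context (delta : {linear Alg L -> bop X}).
Implicit Types (P Q A B : Alg L).

Definition bilocal P A Q :=
  delta (P * A * Q) + (P : bop X) * delta A * (Q : bop X) =
  delta (P * A) * (Q : bop X) + (P : bop X) * delta (A * Q).

Lemma alg_scaleAl a A B : a *: (A * B) = a *: A * B.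
Proof. exact/val_inj/bop_scaleAl. Qed.

Lemma alg_scaleAr a A B : a *: (A * B) = A * (a *: B).
Proof. exact/val_inj/bop_scaleAr. Qed.

Lemma alg_linE a A B : (a *: A + B : Alg L) = a *: (A : bop X) + B :> bop X.
Proof. by []. Qed.

Lemma bilocal_linearl a P P' A Q :
  bilocal P A Q -> bilocal P' A Q -> bilocal (a *: P + P') A Q.
Proof.
rewrite /bilocal => hP hP'.
rewrite alg_linE !mulrDl -!alg_scaleAl !linearP/= !mulrDl -!bop_scaleAl.
by rewrite addrACA -scalerDr hP hP' scalerDr addrACA.
Qed.

Lemma bilocal_linearr a P A Q Q' :
  bilocal P A Q -> bilocal P A Q' -> bilocal P A (a *: Q + Q').
Proof.
rewrite /bilocal => hQ hQ'.
rewrite alg_linE !mulrDr -!alg_scaleAr !linearP/= !mulrDr -!bop_scaleAr.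
by rewrite addrACA -scalerDr hQ hQ' scalerDr addrACA.
Qed.

Context (delta_zero : forall A B C : Alg L, A * B = 0 -> B * C = 0 ->
  (A : bop X) * delta B * (C : bop X) = 0).

(** Cutting [A] by [P] or [1 - P] on the left and [Q] or [1 - Q] on the right gives an element
    killed by the complementary idempotents, so [delta_zero] yields each corner. *)
Lemma bilocal_idempotent P A Q : P * P = P -> Q * Q = Q -> bilocal P A Q.
Proof.
move=> PP QQ; pose P' := 1 - P; pose Q' := 1 - Q.
have PP' : P * P' = 0 by rewrite mulrBr mulr1 PP subrr.
have P'P : P' * P = 0 by rewrite mulrBl mul1r PP subrr.
have QQ' : Q * Q' = 0 by rewrite mulrBr mulr1 QQ subrr.
have Q'Q : Q' * Q = 0 by rewrite mulrBl mul1r QQ subrr.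
have cut (S T U W : Alg L) : S * T = 0 -> U * W = 0 ->
    (S : bop X) * delta (T * A * U) * (W : bop X) = 0.
  by move=> ST UW; rewrite delta_zero// ?mulrA ?ST ?mul0r// -!mulrA UW !mulr0.
have deltaQ' B : delta (B * Q') = delta B - delta (B * Q).
  by rewrite mulrBr mulr1 linearB.
have deltaP' B : delta (P' * A * B) = delta (A * B) - delta (P * A * B).
  by rewrite !mulrBl mul1r linearB.
apply: (@idempotent_cut (bop X)).
- exact: (cut P' P Q Q').
- by have := cut P P' Q Q' PP' QQ'; rewrite deltaP'.
- by have := cut P' P Q' Q P'P Q'Q; rewrite deltaQ'.
- by have := cut P P' Q' Q PP' Q'Q; rewrite deltaP' !deltaQ' opprB addrACA.
Qed.

(** Linearity in each outer argument allows reducing [P] to an idempotent first, then [Q]. *)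
Lemma bilocal_rank_one : separates_closed_subspaces X ->
  forall P A Q, admissible_rank_one P -> admissible_rank_one Q -> bilocal P A Q.
Proof.
move=> sepX P A Q P1 Q1; move: P P1; apply: admissible_rank_one_ind => //.
  by move=> a P P'; exact: bilocal_linearl.
move=> P PP; move: Q Q1; apply: admissible_rank_one_ind => //.
  by move=> a Q Q'; exact: bilocal_linearr.
by move=> Q QQ; exact: bilocal_idempotent.
Qed.

Lemma generalized_derivation_of_zero :
  separates_closed_subspaces X ->
  subspace_join (lattice_P L) = setT ->
  \bigcap_(E in lattice_P L) lattice_minus L E = [set 0] ->
  generalized_derivation delta.
Proof.
move=> sepX joinL meetL A B; apply/eqP; rewrite eq_sym subr_eq eq_sym.
rewrite -subr_eq0; apply/eqP.
apply: (@admissible_rank_one_faithful _ _ L) => // S T S1 T1.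
have SA1 := admissible_rank_oneMr A S1; have BT1 := admissible_rank_oneMl B T1.
have := bilocal_rank_one sepX (A * B) S1 T1.
have := bilocal_rank_one sepX B SA1 T1.
have := bilocal_rank_one sepX A S1 BT1.
have := bilocal_rank_one sepX 1 SA1 BT1.
have valM C D : (C * D : Alg L) = (C : bop X) * D :> bop X by [].
rewrite /bilocal !valM !mulr1 !mul1r !mulrA => h4 h3 h2 h1.
rewrite mulrBr mulrBl !mulrDr !mulrDl !mulrA; apply/eqP; rewrite subr_eq0.
(* [h1] and [h4] have the same total right-hand side as [h2] and [h3], and [delta (S * A * B * T)]
   occurs twice on the left of both sums, so it cancels. *)
have h14 := congr2 +%R h1 h4; have := congr2 +%R h3 h2.
rewrite addrACA [RHS]addrACA [X in _ = X + _]addrC -[RHS]addrACA -h14.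
by rewrite [RHS]addrACA => /addrI ->.
Qed.

End Bilocal.

(** * Local generalized derivations and the cycle of implications *)

Lemma local_generalized_derivation_zero (K : numFieldType)
    (X : normedModType K) (L : subspace_lattice X)
    (delta : {linear Alg L -> bop X}) :
  local_generalized_derivation delta ->
  forall A B C : Alg L, A * B = 0 -> B * C = 0 ->
    (A : bop X) * delta B * (C : bop X) = 0.
Proof.
move=> loc A B C AB BC; have [d [/(_ A B) dAB ->]] := loc B.
have BC0 : (B : bop X) * (C : bop X) = 0.
  exact: (congr1 (fun U : Alg L => U : bop X) BC).
(* Since [d (A * B) = 0], [A * d B] is a combination of terms ending in [B], which [C] kills on the
   right. *)
move: dAB; rewrite AB linear0 => /esym/eqP; rewrite subr_eq add0r => /eqP dAB.
have -> : (A : bop X) * d B =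
    (A : bop X) * d 1 * (B : bop X) - d A * (B : bop X).
  by rewrite -dAB addrC addKr.
by rewrite mulrBl -!mulrA BC0 !mulr0 subrr.
Qed.

Theorem corollary4p4 (R : realType) (K : numFieldType)
    (realK : K = (R : numFieldType) \/ K = (R[i] : numFieldType))
    (X : completeNormedModType K) (L : subspace_lattice X)
    (joinL : subspace_join (lattice_P L) = setT)
    (meetL : \bigcap_(E in lattice_P L) lattice_minus L E = [set 0])
    (delta : {linear Alg L -> bop X}) :
  [<-> generalized_derivation delta;
       local_generalized_derivation delta;
       forall A B C : Alg L, A * B = 0 -> B * C = 0 ->
         (A : bop X) * delta B * (C : bop X) = 0].
Proof.
tfae.
- by move=> d_gd A; exists delta.
- exact: local_generalized_derivation_zero.
- move=> delta_zero; apply: generalized_derivation_of_zero => //.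
  exact: separates_real_or_complex realK X.
Qed.
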